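(* Let $X$ be a Polish space. The generic compact set $K\subseteq X$ is either finite or can be written as the union of a balanced compact set and a finite set.
   Context: ''The generic compact set has property P'' means the set of $K\in\mathcal{K}(X)$ with property P is co-meager in $\mathcal{K}(X)$, the space of non-empty compact subsets of $X$ with the Hausdorff metric. Index sets: given positive integers $a_n$ ($n\ge1$), let $\mathcal{I}_n=\prod_{k=1}^n\{1,\dots,a_k\}$ and $\mathcal{I}=\bigcup_{n\ge1}\mathcal{I}_n$. A map $\Phi\colon 2\mathbb{N}+1\to\mathcal{I}$ (domain: positive odd integers) is an index function according to $\langle a_n\rangle$ if it is surjective and $\Phi(n)\in\bigcup_{k=1}^n\mathcal{I}_k$ for every odd $n$. A compact set $K\subseteq X$ is balanced if $K=\bigcap_{n=1}^\infty\bigcup_{(i_1,\dots,i_n)\in\mathcal{I}_n}C_{i_1\dots i_n}$ for some positive integers $a_n$ and non-empty closed sets $C_{i_1\dots i_n}\subseteq X$ for which there exist positive reals $b_n$ and an index function $\Phi$ according to $\langle a_n\rangle$ such that for all $n\ge1$ and $(i_1,\dots,i_n),(j_1,\dots,j_n)\in\mathcal{I}_n$: (i) $a_1\ge2$ and $a_{n+1}\ge n a_1\cdots a_n$; (ii) $C_{i_1\dots i_{n+1}}\subseteq C_{i_1\dots i_n}$; (iii) $\operatorname{diam}C_{i_1\dots i_n}\le b_n$; (iv) $\operatorname{dist}(C_{i_1\dots i_n},C_{j_1\dots j_n})>2b_n$ if $(i_1,\dots,i_n)\ne(j_1,\dots,j_n)$; (v) if $n$ is odd, $C_{i_1\dots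 i_n}\subseteq C_{\Phi(n)}$ and $C_{j_1\dots j_n}\not\subseteq C_{\Phi(n)}$, then for all $s\ne t$ in $\{1,\dots,a_{n+1}\}$, $\operatorname{dist}(C_{i_1\dots i_n s},C_{i_1\dots i_n t})>\operatorname{diam}\bigl(\bigcup_{j_{n+1}=1}^{a_{n+1}}C_{j_1\dots j_n j_{n+1}}\bigr)$. Here $\operatorname{dist}(A,B)=\inf\{d(x,y):x\in A,y\in B\}$. *)

(* Defs.v *)
From Stdlib Require Import Reals List Arith.
Import ListNotations.
Open Scope R_scope.

Section Metric.
Context {X : Type} (d : X -> X -> R).

Definition is_metric : Prop :=
  (forall x y, 0 <= d x y) /\
  (forall x y, d x y = 0 <-> x = y) /\
  (forall x y, d x y = d y x) /\
  (forall x y z, d x z <= d x y + d y z).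

Definition cauchy (u : nat -> X) : Prop :=
  forall eps, 0 < eps -> exists N, forall m n, (N <= m)%nat -> (N <= n)%nat -> d (u m) (u n) < eps.

Definition converges_to (u : nat -> X) (x : X) : Prop :=
  forall eps, 0 < eps -> exists N, forall n, (N <= n)%nat -> d (u n) x < eps.

Definition mcomplete : Prop :=
  forall u, cauchy u -> exists x, converges_to u x.

(** separable: a countable dense subset (enumerated with possible gaps, to allow X empty) *)
Definition separable : Prop :=
  exists D : nat -> option X,
    forall x eps, 0 < eps -> exists n y, D n = Some y /\ d x y < eps.

Definition mopen (U : X -> Prop) : Prop :=
  forall x, U x -> exists r, 0 < r /\ forall y, d x y < r -> U y.

Definition mclosed (C : X -> Prop) : Prop :=
  forall x, (forall eps, 0 < eps -> exists y, C y /\ d x y < eps) -> C x.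

Definition mcompact (K : X -> Prop) : Prop :=
  forall (I : Type) (U : I -> X -> Prop),
    (forall i, mopen (U i)) -> (forall x, K x -> exists i, U i x) ->
    exists l : list I, forall x, K x -> exists i, In i l /\ U i x.

Definition nonempty (K : X -> Prop) : Prop := exists x, K x.

Definition finite_set (F : X -> Prop) : Prop :=
  exists l : list X, forall x, F x <-> In x l.

Definition subset (A B : X -> Prop) : Prop := forall x, A x -> B x.

Definition diam_le (A : X -> Prop) (b : R) : Prop :=
  forall x y, A x -> A y -> d x y <= b.

(** dist(A,B) = inf { d x y : x in A, y in B } > t *)
Definition dist_gt (A B : X -> Prop) (t : R) : Prop :=
  exists t', t < t' /\ forall x y, A x -> B y -> t' <= d x y.

Definition dist_gt_diam (A B E : X -> Prop) : Prop :=
  exists t, diam_le E t /\ dist_gt A B t.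

Definition KX : Type := { K : X -> Prop | mcompact K /\ nonempty K }.

(** d_H(A,B) <= r, written out: every point of each set is within
    (inf-)distance r of the other set *)
Definition hdist_le (A B : X -> Prop) (r : R) : Prop :=
  (forall x, A x -> forall eps, 0 < eps -> exists y, B y /\ d x y < r + eps) /\
  (forall y, B y -> forall eps, 0 < eps -> exists x, A x /\ d x y < r + eps).

Definition hdist_lt (A B : X -> Prop) (r : R) : Prop :=
  exists r', r' < r /\ hdist_le A B r'.

Definition Kopen (U : KX -> Prop) : Prop :=
  forall A, U A -> exists r, 0 < r /\
    forall B : KX, hdist_lt (proj1_sig A) (proj1_sig B) r -> U B.

Definition Kclosure (N : KX -> Prop) (A : KX) : Prop :=
  forall r, 0 < r -> exists B : KX, N B /\ hdist_lt (proj1_sig A) (proj1_sig B) r.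

Definition Knowhere_dense (N : KX -> Prop) : Prop :=
  forall U : KX -> Prop, Kopen U -> (forall A, U A -> Kclosure N A) ->
    forall A, ~ U A.

Definition Kmeager (M : KX -> Prop) : Prop :=
  exists N : nat -> KX -> Prop, (forall n, Knowhere_dense (N n)) /\
    forall A, M A -> exists n, N n A.

Definition generic (P : (X -> Prop) -> Prop) : Prop :=
  Kmeager (fun A : KX => ~ P (proj1_sig A)).

Fixpoint prod_a (a : nat -> nat) (n : nat) : nat :=
  match n with O => 1%nat | S k => (prod_a a k * a (S k))%nat end.

(** l = (i_1,...,i_n) is in I_n = prod_{k=1}^n {1,...,a_k} *)
Definition idx (a : nat -> nat) (n : nat) (l : list nat) : Prop :=
  length l = n /\
  forall k, (1 <= k <= n)%nat -> (1 <= nth (k - 1) l 0%nat <= a k)%nat.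

(** Phi : odd positive integers -> I is an index function according to <a_n> *)
Definition index_function (a : nat -> nat) (Phi : nat -> list nat) : Prop :=
  (forall m, Nat.Odd m -> exists k, (1 <= k <= m)%nat /\ idx a k (Phi m)) /\
  (forall n l, (1 <= n)%nat -> idx a n l -> exists m, Nat.Odd m /\ Phi m = l).

Definition balanced (K : X -> Prop) : Prop :=
  exists (a : nat -> nat) (C : list nat -> X -> Prop) (b : nat -> R) (Phi : nat -> list nat),
    (forall n, (1 <= n)%nat -> (1 <= a n)%nat) /\
    (forall n, (1 <= n)%nat -> 0 < b n) /\
    (forall n l, (1 <= n)%nat -> idx a n l -> nonempty (C l) /\ mclosed (C l)) /\
    index_function a Phi /\
    (forall x, K x <-> forall n, (1 <= n)%nat -> exists l, idx a n l /\ C l x) /\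
    (2 <= a 1%nat)%nat /\
    (forall n, (1 <= n)%nat -> (n * prod_a a n <= a (S n))%nat) /\
    (forall n l i, (1 <= n)%nat -> idx a n l -> (1 <= i <= a (S n))%nat ->
        subset (C (l ++ [i])) (C l)) /\
    (forall n l, (1 <= n)%nat -> idx a n l -> diam_le (C l) (b n)) /\
    (forall n l l', (1 <= n)%nat -> idx a n l -> idx a n l' -> l <> l' ->
        dist_gt (C l) (C l') (2 * b n)) /\
    (forall n l l', (1 <= n)%nat -> Nat.Odd n -> idx a n l -> idx a n l' ->
        subset (C l) (C (Phi n)) -> ~ subset (C l') (C (Phi n)) ->
        forall s t, (1 <= s <= a (S n))%nat -> (1 <= t <= a (S n))%nat -> s <> t ->
          dist_gt_diam (C (l ++ [s])) (C (l ++ [t]))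
            (fun x => exists j, (1 <= j <= a (S n))%nat /\ C (l' ++ [j]) x)).

End Metric.

(* Main.v *)
(** A configuration records finitely many levels of a balanced scheme by balls
    with centres in a countable dense set and radii [1 / (q + 1)], the root being
    the complement of the closure of the set of isolated points.  That a compact set
    fits a configuration (it lies in the isolated points together with the balls of
    the last level, and meets all of these balls) is an open condition.  Near every
    compact set that fits an even level [n] there is a finite set fitting an
    extension to level [n + 2]: replace a finite net by equally many points in each
    ball of level [n], then each of these points by equally many nearby points,
    chosen first below the index [Phi (n + 1)] and then, at a much smaller scale,
    elsewhere.  Hence, for each of the countably many configurations, the compact
    sets that fit it but none of its extensions are nowhere dense.  A compact set
    outside these sets, and disjoint from the nowhere dense set of non-isolated
    limits of isolated points, fits an infinite chain of configurations, so its
    non-isolated points form a balanced set; the remaining points are finitely many. *)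

Require Import Defs.
From Stdlib Require Import Reals List Arith Lia Lra Cantor Classical ClassicalEpsilon.
Import ListNotations.
Open Scope R_scope.

(** * Choice principles and finite sets *)

Lemma fun_choice {A B : Type} (Q : A -> B -> Prop) :
  (forall x, exists y, Q x y) -> exists f, forall x, Q x (f x).
Proof.
  intros H.
  exists (fun x => proj1_sig (constructive_indefinite_description _ (H x))).
  intros x; apply proj2_sig.
Qed.

(** The step relation is weakened to hold vacuously outside [Q]; it is then total, and a single
    choice function can be iterated. *)
Lemma dependent_choice_nat {A : Type} (Q : nat -> A -> Prop) (T : nat -> A -> A -> Prop) :
  (exists x, Q O x) ->
  (forall n x, Q n x -> exists y, T n x y /\ Q (S n) y) ->
  exists u, forall n, Q n (u n) /\ T n (u n) (u (S n)).
Proof.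
  intros [x0 H0] H.
  assert (Hs : forall p : nat * A, exists y,
             Q (fst p) (snd p) -> T (fst p) (snd p) y /\ Q (S (fst p)) y).
  { intros [n x]; simpl. destruct (classic (Q n x)) as [h|h].
    - destruct (H n x h) as [y hy]. exists y; auto.
    - exists x; tauto. }
  destruct (fun_choice _ Hs) as [f Hf].
  set (u := fix u n := match n with O => x0 | S k => f (k, u k) end).
  assert (Hu : forall n, Q n (u n)).
  { induction n as [|n IH]; [exact H0|]. apply (Hf (n, u n)), IH. }
  exists u; intros n; split; [apply Hu|]. apply (Hf (n, u n)), Hu.
Qed.

Lemma finite_set_subset {T : Type} (A : T -> Prop) l :
  (forall x, A x -> In x l) -> finite_set A.
Proof.
  intros H.
  exists (filter (fun x => if excluded_middle_informative (A x) then true else false) l).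
  intros x. rewrite filter_In.
  destruct (excluded_middle_informative (A x)) as [h|h]; [split; auto|].
  split; [intros h'; contradiction|intros [_ h']; discriminate].
Qed.

(** * Multi-indices *)

Lemma idx_nil a l : idx a 0 l -> l = [].
Proof. intros [H _]. now apply length_zero_iff_nil. Qed.

Lemma idx_0 a : idx a 0 [].
Proof. split; [reflexivity|lia]. Qed.

Lemma idx_snoc a n l i :
  idx a n l -> (1 <= i <= a (S n))%nat -> idx a (S n) (l ++ [i]).
Proof.
  intros [Hl H] Hi. split.
  - rewrite length_app; simpl; lia.
  - intros k Hk. destruct (Nat.eq_dec k (S n)) as [->|Hne].
    + rewrite app_nth2 by lia. replace (S n - 1 - length l)%nat with O by lia. exact Hi.
    + rewrite app_nth1 by lia. apply H; lia.
Qed.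

Lemma idx_S_inv a n l : idx a (S n) l ->
  exists l0 i, l = l0 ++ [i] /\ idx a n l0 /\ (1 <= i <= a (S n))%nat.
Proof.
  intros [Hl H].
  destruct (exists_last (l := l)) as [l0 [i ->]]; [intros ->; discriminate|].
  rewrite length_app in Hl; simpl in Hl.
  exists l0, i. repeat split; try lia.
  - specialize (H k). rewrite app_nth1 in H by lia. lia.
  - specialize (H k). rewrite app_nth1 in H by lia. lia.
  - specialize (H (S n)). rewrite app_nth2 in H by lia.
    replace (S n - 1 - length l0)%nat with O in H by lia. simpl in H; lia.
  - specialize (H (S n)). rewrite app_nth2 in H by lia.
    replace (S n - 1 - length l0)%nat with O in H by lia. simpl in H; lia.
Qed.

Lemma idx_ext a a' n l :
  (forall k, (k <= n)%nat -> a k = a' k) -> idx a n l -> idx a' n l.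
Proof.
  intros Ha [Hl H]. split; [exact Hl|]. intros k Hk. rewrite <- Ha by lia. auto.
Qed.

Lemma idx_length a n l : idx a n l -> length l = n.
Proof. now intros [H _]. Qed.

Lemma idx_firstn a n k l : (k <= n)%nat -> idx a n l -> idx a k (firstn k l).
Proof.
  intros Hk [Hl H]. split.
  - rewrite length_firstn; lia.
  - intros j Hj. rewrite nth_firstn.
    destruct (Nat.ltb_spec (j - 1) k); [apply H; lia|lia].
Qed.

Lemma idx_nonnil a n l : (1 <= n)%nat -> idx a n l -> l <> [].
Proof. intros Hn Hl ->. apply idx_length in Hl. simpl in Hl; lia. Qed.

Lemma idx_finite a n : exists L, forall l, idx a n l -> In l L.
Proof.
  induction n as [|n [L IH]].
  - exists [[]]. intros l H. left. symmetry. exact (idx_nil _ _ H).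
  - exists (flat_map (fun l => map (fun i => l ++ [i]) (seq 1 (a (S n)))) L).
    intros l H. destruct (idx_S_inv _ _ _ H) as [l0 [i [-> [H0 Hi]]]].
    apply in_flat_map. exists l0; split; [auto|].
    apply in_map_iff. exists i; split; [reflexivity|]. apply in_seq; lia.
Qed.

Lemma prod_a_ext a a' n :
  (forall k, (k <= n)%nat -> a k = a' k) -> prod_a a n = prod_a a' n.
Proof.
  induction n as [|n IH]; intros H; simpl; [reflexivity|].
  rewrite IH, H; auto.
Qed.

(** * Enumerations *)

Fixpoint unpack (k z : nat) : list nat :=
  match k with
  | O => []
  | S k => let (x, y) := Cantor.of_nat z in x :: unpack k y
  end.

Definition decode (z : nat) : list nat :=
  let (k, y) := Cantor.of_nat z in unpack k y.

Lemma decode_surjective l : exists z, decode z = l.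
Proof.
  assert (H : exists y, unpack (length l) y = l).
  { induction l as [|x l [y IH]]; [now exists O|].
    exists (Cantor.to_nat (x, y)). cbn [length unpack]. rewrite cancel_of_to. now rewrite IH. }
  destruct H as [y Hy]. exists (Cantor.to_nat (length l, y)).
  unfold decode. now rewrite cancel_of_to.
Qed.

Definition encode (l : list nat) : nat :=
  proj1_sig (constructive_indefinite_description _ (decode_surjective l)).

Lemma decode_encode l : decode (encode l) = l.
Proof. exact (proj2_sig (constructive_indefinite_description _ (decode_surjective l))). Qed.

(** A finite part of a function is coded by one number; this is the source of the countability of
    configurations. *)
Lemma nat_fun_code (f : nat -> nat) n :
  exists z, forall k, (k <= n)%nat -> nth k (decode z) 0%nat = f k.
Proof.
  exists (encode (map f (seq 0 (S n)))). intros k Hk. rewrite decode_encode.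
  rewrite nth_indep with (d' := f O) by (rewrite length_map, length_seq; lia).
  rewrite map_nth, seq_nth by lia. reflexivity.
Qed.

Lemma list_fun_code (f : list nat -> nat) (L : list (list nat)) :
  exists z, forall l, In l L -> nth (encode l) (decode z) 0%nat = f l.
Proof.
  destruct (nat_fun_code (fun k => f (decode k)) (list_max (map encode L))) as [z Hz].
  exists z. intros l Hl. rewrite Hz; [now rewrite decode_encode|].
  assert (H := proj1 (list_max_le (map encode L) _) (le_n _)).
  rewrite Forall_forall in H. apply H. now apply in_map.
Qed.

(* Every list is enumerated at infinitely many odd places, so that each
   multi-index also occurs at a place beyond its own length. *)
Definition Phi (a : nat -> nat) (m : nat) : list nat :=
  let l := decode (fst (Cantor.of_nat (Nat.div2 m))) in
  if excluded_middle_informative (exists k, (1 <= k <= m)%nat /\ idx a k l)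
  then l else [1%nat].

(** The test in [Phi a m] reads [a] only up to [m], so [Phi] at a level is fixed by the levels
    already built. *)
Lemma Phi_ext a a' m :
  (forall k, (k <= m)%nat -> a k = a' k) -> Phi a m = Phi a' m.
Proof.
  intros H. unfold Phi.
  destruct (excluded_middle_informative _) as [h|h];
    destruct (excluded_middle_informative _) as [h'|h']; try reflexivity; exfalso.
  - apply h'. destruct h as [k [Hk h]]. exists k; split; [exact Hk|].
    apply idx_ext with a; [intros; apply H; lia|exact h].
  - apply h. destruct h' as [k [Hk h']]. exists k; split; [exact Hk|].
    apply idx_ext with a'; [intros; symmetry; apply H; lia|exact h'].
Qed.

Lemma Phi_index_function a :
  (forall n, (1 <= n)%nat -> (1 <= a n)%nat) -> index_function a (Phi a).
Proof.
  intros Ha. split.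
  - intros m [j Hm]. unfold Phi.
    destruct (excluded_middle_informative _) as [h|h]; [exact h|].
    exists 1%nat; split; [lia|]. split; [reflexivity|].
    intros k Hk. replace k with 1%nat by lia. simpl. specialize (Ha 1%nat); lia.
  (* The second component of the pair forces [n <= j], so the place [2 * j + 1] is late enough for a
     list of length [n]. *)
  - intros n l Hn Hl. set (j := Cantor.to_nat (encode l, n)).
    exists (2 * j + 1)%nat. split; [now exists j|].
    unfold Phi. replace (Nat.div2 (2 * j + 1)) with j
      by (rewrite Nat.add_1_r; symmetry; apply Nat.div2_succ_double).
    assert (He : decode (fst (Cantor.of_nat j)) = l)
      by (unfold j; rewrite cancel_of_to; apply decode_encode).
    rewrite He. destruct (excluded_middle_informative _) as [h|h]; [reflexivity|].
    exfalso. apply h. exists n. split; [|exact Hl].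
    assert (H := to_nat_non_decreasing (encode l) n). fold j in H. lia.
Qed.

(** * Properties that hold for all sufficiently small radii *)

(** Unlike the existence of one good radius, this notion is closed under finite conjunctions. *)
Definition small (Q : R -> Prop) : Prop :=
  exists e, 0 < e /\ forall r, 0 < r <= e -> Q r.

Lemma small_and Q Q' : small Q -> small Q' -> small (fun r => Q r /\ Q' r).
Proof.
  intros [e [He H]] [e' [He' H']]. exists (Rmin e e'). split; [now apply Rmin_pos|].
  intros r Hr. assert (h := Rmin_l e e'). assert (h' := Rmin_r e e').
  split; [apply H|apply H']; lra.
Qed.

Lemma small_true (Q : R -> Prop) : (forall r, 0 < r -> Q r) -> small Q.
Proof. intros H. exists 1. split; [lra|]. intros r Hr; apply H; lra. Qed.

Lemma small_le c : 0 < c -> small (fun r => r <= c).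
Proof. intros H. exists c. split; [exact H|]. intros; lra. Qed.

Lemma small_imp (A : Prop) Q : (A -> small Q) -> small (fun r => A -> Q r).
Proof.
  intros H. destruct (classic A) as [h|h].
  - destruct (H h) as [e [He H']]. exists e; auto.
  - apply small_true. tauto.
Qed.

Lemma small_in {T : Type} (L : list T) (Q : T -> R -> Prop) :
  (forall t, In t L -> small (Q t)) -> small (fun r => forall t, In t L -> Q t r).
Proof.
  induction L as [|t L IH]; intros H.
  - apply small_true. intros r _ t [].
  - destruct (small_and _ _ (H t (or_introl eq_refl))
                (IH (fun t h => H t (or_intror h)))) as [e [He H']].
    exists e; split; [exact He|]. intros r Hr t' [<-|h]; [exact (proj1 (H' r Hr))|].
    now apply (proj2 (H' r Hr)).
Qed.

Lemma small_idx a n (Q : list nat -> R -> Prop) :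
  (forall l, idx a n l -> small (Q l)) ->
  small (fun r => forall l, idx a n l -> Q l r).
Proof.
  intros H. destruct (idx_finite a n) as [L HL].
  destruct (small_in L (fun l r => idx a n l -> Q l r)) as [e [He H']].
  - intros l _. apply small_imp, H.
  - exists e; split; [exact He|]. intros r Hr l Hl. apply H'; auto.
Qed.

Lemma small_range N (Q : nat -> R -> Prop) :
  (forall s, (1 <= s <= N)%nat -> small (Q s)) ->
  small (fun r => forall s, (1 <= s <= N)%nat -> Q s r).
Proof.
  intros H.
  destruct (small_in (seq 1 N) (fun s r => Q s r)) as [e [He H']].
  - intros s Hs. apply H. apply in_seq in Hs; lia.
  - exists e; split; [exact He|]. intros r Hr s Hs. apply H'; auto. apply in_seq; lia.
Qed.

Lemma small_pos Q : small Q -> exists r, 0 < r /\ Q r.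
Proof. intros [e [He H]]. exists e; split; [exact He|]. apply H; lra. Qed.

(** Radii of this form are coded by natural numbers, as configurations require. *)
Lemma small_inv_nat Q : small Q -> exists q : nat, Q (/ INR (S q)).
Proof.
  intros [e [He H]]. destruct (archimed_cor1 e He) as [N [HN1 HN2]].
  exists (pred N). rewrite Nat.succ_pred by lia. apply H. split; [|lra].
  apply Rinv_0_lt_compat. now apply lt_0_INR.
Qed.

(** * Compact sets and the Hausdorff metric *)

Section Generic.
Context {X : Type} (d : X -> X -> R).
Context (Hmetric : is_metric d).

Local Lemma dpos x y : 0 <= d x y.
Proof. apply Hmetric. Qed.
Local Lemma dzero x y : d x y = 0 -> x = y.
Proof. apply Hmetric. Qed.
Local Lemma drefl x : d x x = 0.
Proof. now apply Hmetric. Qed.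
Local Lemma dsym x y : d x y = d y x.
Proof. apply Hmetric. Qed.
Local Lemma dtri x y z : d x z <= d x y + d y z.
Proof. apply Hmetric. Qed.

Lemma dist_pos x y : x <> y -> 0 < d x y.
Proof.
  intros H. destruct (dpos x y) as [h|h]; [exact h|]. exfalso; apply H, dzero; auto.
Qed.

Lemma mopen_ball x r : mopen d (fun y => d x y < r).
Proof.
  intros y Hy. exists (r - d x y). split; [lra|].
  intros z Hz. assert (h := dtri x y z). lra.
Qed.

Lemma finite_set_compact (l : list X) : mcompact d (fun x => In x l).
Proof.
  intros I V _ HV. induction l as [|x l IH].
  - exists []. intros x [].
  - destruct IH as [L HL]; [intros; apply HV; now right|].
    destruct (HV x) as [i Hi]; [now left|].
    exists (i :: L). intros y [<-|Hy].
    + exists i; split; [now left|exact Hi].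
    + destruct (HL y Hy) as [j [Hj Hjy]]. exists j; split; [now right|exact Hjy].
Qed.

Lemma compact_net K e : mcompact d K -> 0 < e ->
  exists L, (forall x, In x L -> K x) /\
    forall x, K x -> exists y, In y L /\ d x y < e.
Proof.
  intros HK He.
  destruct (HK {x | K x} (fun c y => d (proj1_sig c) y < e)) as [L HL].
  - intros c; apply mopen_ball.
  - intros x Hx. exists (exist _ x Hx). simpl. rewrite drefl; exact He.
  - exists (map (@proj1_sig _ _) L). split.
    + intros x Hx. apply in_map_iff in Hx. destruct Hx as [c [<- _]]. apply proj2_sig.
    + intros x Hx. destruct (HL x Hx) as [c [Hc Hd]]. exists (proj1_sig c).
      split; [now apply in_map|]. now rewrite dsym.
Qed.

Lemma compact_thickening K W : mcompact d K -> mopen d W -> subset K W ->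
  exists r, 0 < r /\ forall x y, K x -> d x y < r -> W y.
Proof.
  intros HK HW Hs.
  (* The requirement on the pair is part of the covering set: an unsuitable pair contributes the
     empty set. The factor 2 leaves room for a further move by the smallest radius of the
     subcover. *)
  destruct (HK (X * R)%type
    (fun p y => (0 < snd p /\ forall z, d (fst p) z < 2 * snd p -> W z)
                /\ d (fst p) y < snd p)) as [L HL].
  - intros [x r] y [H Hy]; simpl in *.
    destruct (mopen_ball x r y Hy) as [s [Hs0 Hs1]]. exists s; split; auto.
  - intros x Hx. destruct (HW x (Hs x Hx)) as [r [Hr H]].
    exists (x, r / 2); simpl. rewrite drefl. repeat split; try lra.
    intros z Hz; apply H; lra.
  - destruct (small_in L (fun p r => 0 < snd p -> r <= snd p)) as [r [Hr H]].
    + intros p _. apply small_imp, small_le.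
    + exists r; split; [exact Hr|]. intros x y Hx Hxy.
      destruct (HL x Hx) as [p [Hp [[Hp0 Hp1] Hp2]]]. apply Hp1.
      assert (h := dtri (fst p) x y).
      assert (h' := H r ltac:(lra) p Hp Hp0). lra.
Qed.

(** A cover of the difference becomes a cover of [K] once [W] is added, as the member [None]. *)
Lemma compact_inter_closed K W : mcompact d K -> mopen d W ->
  mcompact d (fun x => K x /\ ~ W x).
Proof.
  intros HK HW I V HV Hc.
  destruct (HK (option I) (fun o => match o with Some i => V i | None => W end))
    as [L HL].
  - intros [i|]; auto.
  - intros x Hx. destruct (classic (W x)) as [h|h]; [now exists None|].
    destruct (Hc x (conj Hx h)) as [i Hi]. now exists (Some i).
  - exists (flat_map (fun o => match o with Some i => [i] | None => [] end) L).
    intros x [Hx Hn]. destruct (HL x Hx) as [[i|] [Hi Hix]]; [|contradiction].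
    exists i; split; [|exact Hix]. apply in_flat_map. exists (Some i).
    split; [exact Hi|now left].
Qed.

Lemma compact_closed K : mcompact d K -> mclosed d K.
Proof.
  intros HK x Hx. apply NNPP; intros Hn.
  assert (Ho : mopen d (fun y => y <> x)).
  { intros y Hy. exists (d y x). split; [now apply dist_pos|].
    intros z Hz ->. lra. }
  destruct (compact_thickening K _ HK Ho) as [r [Hr H]].
  - intros y Hy E. apply Hn. now rewrite <- E.
  - destruct (Hx r Hr) as [y [Hy Hxy]]. apply (H y x Hy); [now rewrite dsym|reflexivity].
Qed.

Lemma hdist_lt_intro (A B : X -> Prop) r e : e < r ->
  (forall x, A x -> exists y, B y /\ d x y < e) ->
  (forall y, B y -> exists x, A x /\ d x y < e) -> hdist_lt d A B r.
Proof.
  intros Her H1 H2. exists e; split; [exact Her|]. split.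
  - intros x Hx eps Heps. destruct (H1 x Hx) as [y [Hy Hd]]. exists y; split; [exact Hy|lra].
  - intros y Hy eps Heps. destruct (H2 y Hy) as [x [Hx Hd]]. exists x; split; [exact Hx|lra].
Qed.

Lemma hdist_lt_l (A B : X -> Prop) r x :
  hdist_lt d A B r -> A x -> exists y, B y /\ d x y < r.
Proof.
  intros [r' [Hr [H _]]] Hx. destruct (H x Hx (r - r')) as [y [Hy Hd]]; [lra|].
  exists y; split; [exact Hy|lra].
Qed.

Lemma hdist_lt_r (A B : X -> Prop) r y :
  hdist_lt d A B r -> B y -> exists x, A x /\ d x y < r.
Proof.
  intros [r' [Hr [_ H]]] Hy. destruct (H y Hy (r - r')) as [x [Hx Hd]]; [lra|].
  exists x; split; [exact Hx|lra].
Qed.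

Lemma small_hdist (A : KX d) (O : KX d -> Prop) r : 0 < r ->
  (forall B : KX d, hdist_lt d (proj1_sig A) (proj1_sig B) r -> O B) ->
  small (fun r => forall B : KX d, hdist_lt d (proj1_sig A) (proj1_sig B) r -> O B).
Proof.
  intros Hr H. exists r; split; [exact Hr|].
  intros s Hs B [r' [Hr' HB]]. apply H. exists r'; split; [lra|exact HB].
Qed.

Lemma Kopen_subset W : mopen d W -> Kopen d (fun A => subset (proj1_sig A) W).
Proof.
  intros HW [A [HA HA']] Hs; simpl in *.
  destruct (compact_thickening A W HA HW Hs) as [r [Hr H]].
  exists r; split; [exact Hr|]. intros B HB y Hy.
  destruct (hdist_lt_r _ _ _ _ HB Hy) as [x [Hx Hd]]. now apply (H x).
Qed.

Lemma Kopen_meets W : mopen d W ->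
  Kopen d (fun A => exists x, proj1_sig A x /\ W x).
Proof.
  intros HW A [x [Hx HWx]]. destruct (HW x HWx) as [r [Hr H]].
  exists r; split; [exact Hr|]. intros B HB.
  destruct (hdist_lt_l _ _ _ _ HB Hx) as [y [Hy Hd]]. exists y; auto.
Qed.

(** If [N] were dense in an open [V], a member of [N] in [V] could be moved within [V] into [O];
    density near the new point contradicts that [O] misses [N]. *)
Lemma Knowhere_dense_intro (N : KX d -> Prop) :
  (forall A r, N A -> 0 < r -> exists (B : KX d) (O : KX d -> Prop),
     Kopen d O /\ O B /\ hdist_lt d (proj1_sig A) (proj1_sig B) r /\
     forall C, O C -> ~ N C) ->
  Knowhere_dense d N.
Proof.
  intros H V HV Hc A HA.
  destruct (HV A HA) as [r [Hr Hr']]. destruct (Hc A HA r Hr) as [B [HB HAB]].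
  assert (VB := Hr' B HAB).
  destruct (HV B VB) as [s [Hs Hs']].
  destruct (H B s HB Hs) as [C [O [HO [OC [HBC Hn]]]]].
  assert (VC := Hs' C HBC).
  destruct (HO C OC) as [t [Ht Ht']].
  destruct (Hc C VC t Ht) as [E [HE HCE]]. exact (Hn E (Ht' E HCE) HE).
Qed.

Lemma finite_KX (A : X -> Prop) : finite_set A -> nonempty A ->
  exists B : KX d, forall x, proj1_sig B x <-> A x.
Proof.
  intros [l Hl] [x0 Hx0].
  assert (H : mcompact d (fun x => In x l) /\ nonempty (fun x => In x l)).
  { split; [apply finite_set_compact|]. exists x0; now apply Hl. }
  exists (exist (fun K => mcompact d K /\ nonempty K) _ H).
  intros x; split; apply Hl.
Qed.

(** * Isolated points *)

Definition isolated (x : X) : Prop := exists r, 0 < r /\ forall y, d x y < r -> y = x.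

(** This is the interior of the set of non-isolated points; that set itself is closed but in general
    not open, whereas the root has to be open. *)
Definition perfect_part (x : X) : Prop :=
  exists r, 0 < r /\ forall y, d x y < r -> ~ isolated y.

Lemma isolated_open : mopen d isolated.
Proof.
  intros x [r [Hr H]]. exists r; split; [exact Hr|].
  intros y Hy. rewrite (H y Hy). exists r; auto.
Qed.

Lemma perfect_part_open : mopen d perfect_part.
Proof.
  intros x [r [Hr H]]. exists (r / 2); split; [lra|].
  intros y Hy. exists (r / 2); split; [lra|].
  intros z Hz. apply H. assert (h := dtri x y z). lra.
Qed.

Lemma perfect_part_not_isolated x : perfect_part x -> ~ isolated x.
Proof. intros [r [Hr H]]. apply H. rewrite drefl; exact Hr. Qed.

Lemma isolated_or_perfect_dense x e : 0 < e ->
  exists y, (isolated y \/ perfect_part y) /\ d x y < e.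
Proof.
  intros He. destruct (classic (perfect_part x)) as [h|h].
  - exists x; split; [now right|]. rewrite drefl; exact He.
  - apply NNPP; intros Hn. apply h. exists e; split; [exact He|].
    intros y Hy Hi. apply Hn. exists y; auto.
Qed.

Lemma mopen_or V W : mopen d V -> mopen d W -> mopen d (fun x => V x \/ W x).
Proof.
  intros HV HW x [h|h].
  - destruct (HV x h) as [r [Hr H]]. exists r; auto.
  - destruct (HW x h) as [r [Hr H]]. exists r; auto.
Qed.

(** A finite net of [A] is moved into the dense open set of isolated and perfect points, and
    inclusion in an open set is an open condition. *)
Lemma nowhere_dense_boundary :
  Knowhere_dense d (fun A => ~ subset (proj1_sig A) (fun x => isolated x \/ perfect_part x)).
Proof.
  apply Knowhere_dense_intro. intros [A [HA HA']] r _ Hr; simpl.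
  destruct (compact_net A (r / 4) HA) as [L [HL1 HL2]]; [lra|].
  assert (Hf : forall x, exists y, (isolated y \/ perfect_part y) /\ d x y < r / 4)
    by (intros; apply isolated_or_perfect_dense; lra).
  destruct (fun_choice _ Hf) as [f Hf'].
  destruct (finite_KX (fun x => In x (map f L))) as [B HB].
  { now exists (map f L). }
  { destruct HA' as [x Hx]. destruct (HL2 x Hx) as [y [Hy _]].
    exists (f y). now apply in_map. }
  exists B, (fun C => subset (proj1_sig C) (fun x => isolated x \/ perfect_part x)).
  repeat split.
  - apply Kopen_subset, mopen_or; [apply isolated_open|apply perfect_part_open].
  - intros x Hx. apply HB, in_map_iff in Hx. destruct Hx as [y [<- _]]. apply Hf'.
  - apply hdist_lt_intro with (r / 2); [lra| |].
    + intros x Hx. destruct (HL2 x Hx) as [y [Hy Hd]]. exists (f y).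
      split; [now apply HB, in_map|].
      assert (h := dtri x y (f y)). assert (h' := proj2 (Hf' y)). lra.
    + intros y Hy. apply HB, in_map_iff in Hy. destruct Hy as [x [<- Hx]].
      exists x; split; [auto|]. assert (h' := proj2 (Hf' x)). lra.
  - tauto.
Qed.

(** * Configurations *)

Context (D : nat -> X).
Context (HD : forall x e, 0 < e -> exists n, d x (D n) < e).

(* The data of levels [1..n] of a balanced scheme: the sequence [a_k], the
   centres (as indices into the dense sequence [D]) of balls [B_l] and their
   radii [1 / (cr k + 1)].  Only countably many such data matter up to a given
   level, which is what makes the exceptional set meager. *)
Record config := Config { ca : nat -> nat; cx : list nat -> nat; cr : nat -> nat }.

Definition pt (c : config) (l : list nat) : X := D (cx c l).
Definition rad (c : config) (k : nat) : R := / INR (S (cr c k)).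

(* The root of the tree is the perfect part of the space. *)
Definition Ball (c : config) (l : list nat) (y : X) : Prop :=
  match l with
  | [] => perfect_part y
  | _ => d (pt c l) y < rad c (length l)
  end.

(** Only finitely many values are compared, so every configuration agrees up to [n] with one of
    countably many. *)
Definition agree (n : nat) (c c' : config) : Prop :=
  (forall k, (k <= n)%nat -> ca c k = ca c' k /\ cr c k = cr c' k) /\
  (forall k l, (k <= n)%nat -> idx (ca c) k l -> cx c l = cx c' l).

(** The combinatorial counterpart of the inclusion of the piece at [l] in the piece at [p]. *)
Definition below (p l : list nat) : Prop := firstn (length p) l = p.

(** The passage from level [k] to [S k]. The constants leave room for points up to one radius away
    from the centres: 7 radii between centres leave 5 between points, more than twice the diameter
    bound of 2 radii. In the last clause the diameter grows by 2 radii and the distance drops by 2,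
    so 5 leaves one radius for strictness. *)
Definition Step (k : nat) (c : config) : Prop :=
  (2 <= ca c (S k))%nat /\ (k * prod_a (ca c) k <= ca c (S k))%nat /\
  (forall l i y, idx (ca c) k l -> (1 <= i <= ca c (S k))%nat ->
     d (pt c (l ++ [i])) y <= rad c (S k) -> Ball c l y) /\
  (forall l l', idx (ca c) (S k) l -> idx (ca c) (S k) l' -> l <> l' ->
     7 * rad c (S k) < d (pt c l) (pt c l')) /\
  (Nat.Odd k -> forall l l' s t i j, idx (ca c) k l -> idx (ca c) k l' ->
     below (Phi (ca c) k) l -> ~ below (Phi (ca c) k) l' ->
     (1 <= s <= ca c (S k))%nat -> (1 <= t <= ca c (S k))%nat -> s <> t ->
     (1 <= i <= ca c (S k))%nat -> (1 <= j <= ca c (S k))%nat ->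
     d (pt c (l' ++ [i])) (pt c (l' ++ [j])) + 5 * rad c (S k)
       <= d (pt c (l ++ [s])) (pt c (l ++ [t]))).

Definition Geom (n : nat) (c : config) : Prop := forall k, (k < n)%nat -> Step k c.

(** At level 0 this says that [K] avoids the boundary of the set of isolated points and meets the
    perfect part. *)
Definition Fits (n : nat) (c : config) (K : X -> Prop) : Prop :=
  subset K (fun x => isolated x \/ exists l, idx (ca c) n l /\ Ball c l x) /\
  forall l, idx (ca c) n l -> exists x, K x /\ Ball c l x.

Lemma rad_pos c k : 0 < rad c k.
Proof. apply Rinv_0_lt_compat, lt_0_INR; lia. Qed.

Lemma Ball_snoc c l i y : Ball c (l ++ [i]) y <-> d (pt c (l ++ [i])) y < rad c (S (length l)).
Proof.
  unfold Ball. destruct (l ++ [i]) eqn:E; [destruct l; discriminate|].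
  rewrite <- E, length_app, Nat.add_comm. reflexivity.
Qed.

Lemma Ball_open c l : mopen d (Ball c l).
Proof. destruct l; [apply perfect_part_open|apply mopen_ball]. Qed.

Lemma agree_sym n c c' : agree n c c' -> agree n c' c.
Proof.
  intros [H1 H2]. split.
  - intros k Hk. destruct (H1 k Hk); auto.
  - intros k l Hk Hl. symmetry. apply (H2 k); [exact Hk|].
    apply idx_ext with (ca c'); [|exact Hl]. intros j Hj. symmetry; apply H1; lia.
Qed.

Lemma agree_le m n c c' : (m <= n)%nat -> agree n c c' -> agree m c c'.
Proof.
  intros Hm [H1 H2]. split.
  - intros k Hk. apply H1; lia.
  - intros k l Hk. apply H2; lia.
Qed.

Lemma agree_trans n c1 c2 c3 : agree n c1 c2 -> agree n c2 c3 -> agree n c1 c3.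
Proof.
  intros [H1 H2] [H3 H4]. split.
  - intros k Hk. destruct (H1 k Hk), (H3 k Hk). split; congruence.
  - intros k l Hk Hl. rewrite (H2 k l Hk Hl). apply (H4 k); [exact Hk|].
    apply idx_ext with (ca c1); [|exact Hl]. intros j Hj; apply H1; lia.
Qed.

Lemma agree_idx n c c' k l : agree n c c' -> (k <= n)%nat ->
  idx (ca c) k l -> idx (ca c') k l.
Proof. intros [H _] Hk. apply idx_ext. intros j Hj; apply H; lia. Qed.

Lemma agree_pt n c c' k l : agree n c c' -> (k <= n)%nat ->
  idx (ca c) k l -> pt c l = pt c' l.
Proof. intros [_ H] Hk Hl. unfold pt. now rewrite (H k). Qed.

Lemma agree_rad n c c' k : agree n c c' -> (k <= n)%nat -> rad c k = rad c' k.
Proof. intros [H _] Hk. unfold rad. now rewrite (proj2 (H k Hk)). Qed.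

Lemma agree_Ball n c c' k l y : agree n c c' -> (k <= n)%nat ->
  idx (ca c) k l -> Ball c l y -> Ball c' l y.
Proof.
  intros H Hk Hl. unfold Ball. destruct l as [|i l]; [auto|].
  rewrite <- (agree_pt n c c' k), <- (agree_rad n c c'); auto.
  rewrite (idx_length _ _ _ Hl); exact Hk.
Qed.

Lemma agree_Step n c c' k : agree n c c' -> (k < n)%nat -> Step k c -> Step k c'.
Proof.
  intros H Hk (Ha2 & Hap & Hn & Hs & Ho).
  assert (Ea : forall j, (j <= n)%nat -> ca c j = ca c' j) by (intros; now apply H).
  assert (H' := agree_sym _ _ _ H).
  assert (Ei : forall j l, (j <= n)%nat -> idx (ca c') j l -> idx (ca c) j l)
    by (intros; eapply agree_idx; eauto).
  assert (Ep : forall l i, idx (ca c') k l -> (1 <= i <= ca c (S k))%nat ->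
            pt c (l ++ [i]) = pt c' (l ++ [i])).
  { intros l i Hl Hi. eapply (agree_pt n _ _ (S k)); [exact H|lia|].
    apply idx_snoc; [|exact Hi]. apply Ei; [lia|exact Hl]. }
  assert (Er := agree_rad n c c' (S k) H Hk).
  unfold Step. rewrite <- (Ea (S k) Hk).
  rewrite <- (prod_a_ext (ca c)) by (intros; apply Ea; lia).
  rewrite <- (Phi_ext (ca c)) by (intros; apply Ea; lia).
  rewrite <- Er. split; [exact Ha2|split; [exact Hap|]]. split; [|split].
  - intros l i y Hl Hi Hd. apply (agree_Ball n c c' k); [exact H|lia|apply Ei; [lia|exact Hl]|].
    rewrite <- Ep in Hd by auto. apply (Hn l i); auto. apply Ei; [lia|exact Hl].
  - intros l l' Hl Hl' Hne. apply Ei in Hl; [|lia]. apply Ei in Hl'; [|lia].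
    rewrite <- (agree_pt n c c' (S k) l), <- (agree_pt n c c' (S k) l'); auto.
  - intros Hk' l l' s t i j Hl Hl' Hb Hb' Hs' Ht' Hst Hi Hj.
    rewrite <- !Ep by auto. apply Ho; auto; apply Ei; auto; lia.
Qed.

Lemma agree_Geom n c c' : agree n c c' -> Geom n c -> Geom n c'.
Proof. intros H HG k Hk. apply (agree_Step n c); auto. Qed.

Lemma agree_Fits n c c' K : agree n c c' -> Fits n c K -> Fits n c' K.
Proof.
  intros H [H1 H2]. split.
  - intros x Hx. destruct (H1 x Hx) as [h|[l [Hl HB]]]; [now left|right].
    exists l; split; [eapply agree_idx; eauto|eapply agree_Ball; eauto].
  - intros l Hl. eapply agree_idx in Hl; [|apply agree_sym; exact H|lia].
    destruct (H2 l Hl) as [x [Hx HB]]. exists x; split; [exact Hx|].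
    eapply agree_Ball; eauto.
Qed.

(** There are finitely many multi-indices of level [n], so this is a finite conjunction of open
    conditions: one inclusion in an open set, and one open set to be met for each multi-index. *)
Lemma Fits_open n c : Kopen d (fun A => Fits n c (proj1_sig A)).
Proof.
  intros A [H1 H2].
  assert (Ho : mopen d (fun x => isolated x \/ exists l, idx (ca c) n l /\ Ball c l x)).
  { apply mopen_or; [apply isolated_open|]. intros x [l [Hl HB]].
    destruct (Ball_open c l x HB) as [r [Hr H]]. exists r; split; [exact Hr|].
    intros y Hy. exists l; auto. }
  destruct (Kopen_subset _ Ho A H1) as [r [Hr H]].
  destruct (small_pos _ (small_and _ _ (small_hdist A _ r Hr H)
    (small_idx (ca c) n (fun l r => forall B : KX d,
       hdist_lt d (proj1_sig A) (proj1_sig B) r ->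
       exists x, proj1_sig B x /\ Ball c l x)
       (fun l Hl => let '(ex_intro _ r (conj Hr Hm)) :=
                      Kopen_meets _ (Ball_open c l) A (H2 l Hl) in
                    small_hdist A _ r Hr Hm)))) as [s [Hs [Hs1 Hs2]]].
  exists s; split; [exact Hs|]. intros B HB. split; [now apply Hs1|].
  intros l Hl. now apply Hs2.
Qed.

Lemma Ball_perfect n c k l y : Geom n c -> (k <= n)%nat -> idx (ca c) k l ->
  Ball c l y -> perfect_part y.
Proof.
  intros HG. revert l. induction k as [|k IH]; intros l Hk Hl HB.
  - rewrite (idx_nil _ _ Hl) in HB. exact HB.
  - destruct (idx_S_inv _ _ _ Hl) as [l0 [i [-> [Hl0 Hi]]]].
    apply (IH l0); [lia|exact Hl0|].
    destruct (HG k ltac:(lia)) as (_ & _ & Hn & _). apply (Hn l0 i); auto.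
    apply Ball_snoc in HB. rewrite (idx_length _ _ _ Hl0) in HB. lra.
Qed.

Lemma Ball_disjoint n c k l l' y : Geom n c -> (k <= n)%nat ->
  idx (ca c) k l -> idx (ca c) k l' -> Ball c l y -> Ball c l' y -> l = l'.
Proof.
  intros HG Hk Hl Hl' HB HB'. destruct k as [|k].
  - now rewrite (idx_nil _ _ Hl), (idx_nil _ _ Hl').
  - apply NNPP; intros Hne.
    destruct (HG k ltac:(lia)) as (_ & _ & _ & Hs & _).
    assert (h := Hs l l' Hl Hl' Hne).
    destruct (idx_S_inv _ _ _ Hl) as [l0 [i [-> [Hl0 _]]]].
    destruct (idx_S_inv _ _ _ Hl') as [l1 [j [-> [Hl1 _]]]].
    apply Ball_snoc in HB. apply Ball_snoc in HB'.
    rewrite (idx_length _ _ _ Hl0) in HB. rewrite (idx_length _ _ _ Hl1) in HB'.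
    assert (h1 := dtri (pt c (l0 ++ [i])) y (pt c (l1 ++ [j]))).
    rewrite (dsym y) in h1. assert (h2 := rad_pos c (S k)). lra.
Qed.

(** * Spreading points in the perfect part and extending configurations *)

(** By induction on [L], puncturing [V] at each point of the list: the punctured set stays
    non-empty, since a one-point open set would consist of an isolated point. *)
Lemma perfect_dense_avoid V L : mopen d V -> (forall x, V x -> perfect_part x) ->
  nonempty V -> exists q, V (D q) /\ ~ In (D q) L.
Proof.
  revert V. induction L as [|z L IH]; intros V HV HP [x Hx].
  - destruct (HV x Hx) as [r [Hr H]]. destruct (HD x r Hr) as [q Hq]. exists q; auto.
  - destruct (IH (fun y => V y /\ y <> z)) as [q [[Hq Hqz] HqL]].
    + intros y [Hy Hyz]. destruct (HV y Hy) as [r [Hr H]].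
      exists (Rmin r (d y z)). split; [apply Rmin_pos; [exact Hr|now apply dist_pos]|].
      intros w Hw. assert (h := Rmin_l r (d y z)). assert (h' := Rmin_r r (d y z)).
      split; [apply H; lra|]. intros ->. lra.
    + intros y [Hy _]; auto.
    + destruct (classic (x = z)) as [<-|h]; [|now exists x].
      apply NNPP; intros Hn. apply (perfect_part_not_isolated x (HP x Hx)).
      destruct (HV x Hx) as [r [Hr H]]. exists r; split; [exact Hr|].
      intros y Hy. apply NNPP; intros Hyx. apply Hn. exists y; auto.
    + exists q; split; [exact Hq|]. intros [E|E]; auto.
Qed.

(** The list [ps] may have repetitions, so a constant list is spread into a cluster of distinct
    points. Distinctness concerns the points, not their indices, since [D] may repeat values. *)
Lemma perfect_spread V ps e : mopen d V -> (forall x, V x -> perfect_part x) ->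
  (forall p, In p ps -> V p) -> 0 < e ->
  exists qs : list nat, length qs = length ps /\ NoDup (map D qs) /\
    forall i p0, (i < length ps)%nat ->
      V (D (nth i qs O)) /\ d (nth i ps p0) (D (nth i qs O)) < e.
Proof.
  intros HV HP Hps He. induction ps as [|p ps IH].
  - exists []. split; [reflexivity|split; [apply NoDup_nil|]]. simpl; lia.
  - destruct IH as [qs [Hlen [Hnd H]]]; [intros; apply Hps; now right|].
    destruct (perfect_dense_avoid (fun y => V y /\ d p y < e) (map D qs))
      as [q [[Hq Hqe] Hqs]].
    + intros y [Hy Hye]. destruct (HV y Hy) as [r [Hr Hr']].
      destruct (mopen_ball p e y Hye) as [s [Hs Hs']].
      exists (Rmin r s). split; [now apply Rmin_pos|].
      assert (h := Rmin_l r s). assert (h' := Rmin_r r s).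
      intros z Hz. split; [apply Hr'|apply Hs']; lra.
    + intros y [Hy _]; auto.
    + exists p. split; [apply Hps; now left|rewrite drefl; exact He].
    + exists (q :: qs). split; [simpl; lia|split].
      * simpl. now constructor.
      * intros [|i] p0 Hi; [now split|]. simpl. apply H. simpl in Hi; lia.
Qed.

Lemma spread_family n c N ps e : Geom n c -> 0 < e ->
  (forall l, idx (ca c) n l -> length (ps l) = N /\ forall p, In p (ps l) -> Ball c l p) ->
  exists f : list nat -> nat -> nat, forall l s, idx (ca c) n l -> (1 <= s <= N)%nat ->
    Ball c l (D (f l s)) /\
    (forall p0, d (nth (s - 1) (ps l) p0) (D (f l s)) < e) /\
    forall t, (1 <= t <= N)%nat -> s <> t -> D (f l s) <> D (f l t).
Proof.
  intros HG He Hps.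
  assert (H : forall l, exists qs : list nat, idx (ca c) n l ->
    length qs = N /\ NoDup (map D qs) /\ forall i p0, (i < N)%nat ->
      Ball c l (D (nth i qs O)) /\ d (nth i (ps l) p0) (D (nth i qs O)) < e).
  { intros l. destruct (classic (idx (ca c) n l)) as [h|h]; [|exists []; tauto].
    destruct (Hps l h) as [Hlen Hin].
    destruct (perfect_spread (Ball c l) (ps l) e) as [qs Hqs]; auto.
    - apply Ball_open.
    - intros x. eapply Ball_perfect; eauto.
    - exists qs. rewrite Hlen in Hqs. auto. }
  destruct (fun_choice _ H) as [g Hg].
  exists (fun l s => nth (s - 1) (g l) O). intros l s Hl Hs.
  destruct (Hg l Hl) as [Hlen [Hnd Hn]].
  split; [apply (Hn _ (D O)); lia|split; [intros; apply Hn; lia|]].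
  intros t Ht Hst E. apply Hst.
  rewrite <- !(map_nth D) in E.
  apply (proj1 (NoDup_nth (map D (g l)) (D O)) Hnd) in E; rewrite ?length_map; lia.
Qed.

Definition extend (n : nat) (c : config) (N : nat) (f : list nat -> nat -> nat) (q : nat) :
  config :=
  Config (fun k => if k =? S n then N else ca c k)%nat
         (fun l => if (length l =? S n)%nat then f (removelast l) (last l O) else cx c l)
         (fun k => if k =? S n then q else cr c k)%nat.

Lemma extend_agree n c N f q : agree n c (extend n c N f q).
Proof.
  split.
  - intros k Hk. simpl. destruct (Nat.eqb_spec k (S n)); [lia|auto].
  - intros k l Hk Hl. simpl. rewrite (idx_length _ _ _ Hl).
    destruct (Nat.eqb_spec k (S n)); [lia|reflexivity].
Qed.

Lemma extend_pt n c N f q l s : idx (ca c) n l ->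
  pt (extend n c N f q) (l ++ [s]) = D (f l s).
Proof.
  intros Hl. unfold pt; simpl. rewrite length_app, (idx_length _ _ _ Hl), Nat.add_1_r.
  now rewrite Nat.eqb_refl, removelast_last, last_last.
Qed.

Lemma extend_ca n c N f q : ca (extend n c N f q) (S n) = N.
Proof. simpl. now rewrite Nat.eqb_refl. Qed.

Lemma extend_rad n c N f q : rad (extend n c N f q) (S n) = / INR (S q).
Proof. unfold rad; simpl. now rewrite Nat.eqb_refl. Qed.

(* At an odd level the points outside the branch [Phi n] are clustered at a
   scale chosen after those inside the branch. *)
Lemma one_level_extension n c N ps e : Geom n c -> 0 < e ->
  (2 <= N)%nat -> (n * prod_a (ca c) n <= N)%nat ->
  (forall l, idx (ca c) n l -> length (ps l) = N /\ forall p, In p (ps l) -> Ball c l p) ->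
  (Nat.Odd n -> forall l p p', idx (ca c) n l -> In p (ps l) -> In p' (ps l) -> p = p') ->
  exists c', agree n c c' /\ Geom (S n) c' /\ ca c' (S n) = N /\
    forall l s p0, idx (ca c) n l -> (1 <= s <= N)%nat ->
      d (nth (s - 1) (ps l) p0) (pt c' (l ++ [s])) < e.
Proof.
  intros HG He HN2 HNp Hps Hcst.
  destruct (spread_family n c N ps e HG He Hps) as [f1 Hf1].
  (* The scale [sg] of the clusters is at most a tenth of every separation in the first family. A
     cluster has diameter at most [2 * sg] and the radius will be at most [sg], so the last clause
     of [Step] needs only [7 * sg]. *)
  assert (Hsig : small (fun sg => forall l, idx (ca c) n l ->
    forall s, (1 <= s <= N)%nat -> forall t, (1 <= t <= N)%nat -> s <> t ->
      10 * sg <= d (D (f1 l s)) (D (f1 l t)))).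
  { apply small_idx; intros l Hl. apply small_range; intros s Hs.
    apply small_range; intros t Ht. apply small_imp; intros Hst.
    destruct (small_le (d (D (f1 l s)) (D (f1 l t)) / 10)) as [r [Hr H]].
    - assert (h := dist_pos _ _ (proj2 (proj2 (Hf1 l s Hl Hs)) t Ht Hst)). lra.
    - exists r; split; [exact Hr|]. intros r' Hr'. specialize (H r' Hr'). lra. }
  destruct (small_pos _ (small_and _ _ Hsig (small_le e He))) as [sg [Hsg0 [Hsg Hsge]]].
  destruct (spread_family n c N ps sg HG Hsg0 Hps) as [f2 Hf2].
  set (inside := fun l => below (Phi (ca c) n) l).
  set (f := fun l => if excluded_middle_informative (inside l) then f1 l else f2 l).
  assert (Hf : forall l s, idx (ca c) n l -> (1 <= s <= N)%nat ->
    Ball c l (D (f l s)) /\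
    (forall p0, d (nth (s - 1) (ps l) p0) (D (f l s)) < e) /\
    forall t, (1 <= t <= N)%nat -> s <> t -> D (f l s) <> D (f l t)).
  { intros l s Hl Hs. unfold f. destruct (excluded_middle_informative _); [auto|].
    destruct (Hf2 l s Hl Hs) as (h1 & h2 & h3). repeat split; auto.
    intros p0. specialize (h2 p0). lra. }
  (* At an odd level [ps l] is constant, so all points chosen for [l] lie within [sg] of one common
     point. *)
  assert (Hclust : Nat.Odd n -> forall l i j, idx (ca c) n l -> ~ inside l ->
    (1 <= i <= N)%nat -> (1 <= j <= N)%nat -> d (D (f l i)) (D (f l j)) <= 2 * sg).
  { intros Hodd l i j Hl Hin Hi Hj. unfold f.
    destruct (excluded_middle_informative _) as [h|_]; [contradiction|].
    assert (h1 := proj1 (proj2 (Hf2 l i Hl Hi)) (D O)).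
    assert (h2 := proj1 (proj2 (Hf2 l j Hl Hj)) (D O)).
    destruct (Hps l Hl) as [Hlen _].
    rewrite (Hcst Hodd l (nth (i - 1) (ps l) (D O)) (nth (j - 1) (ps l) (D O))) in h1;
      [|exact Hl|apply nth_In; lia|apply nth_In; lia].
    rewrite dsym in h1.
    assert (h3 := dtri (D (f2 l i)) (nth (j - 1) (ps l) (D O)) (D (f2 l j))). lra. }
  assert (Hrad : small (fun r =>
    (forall l, idx (ca c) n l -> forall s, (1 <= s <= N)%nat ->
       forall y, d (D (f l s)) y <= r -> Ball c l y) /\
    (forall l, idx (ca c) n l -> forall l', idx (ca c) n l' ->
       forall s, (1 <= s <= N)%nat -> forall t, (1 <= t <= N)%nat ->
       l ++ [s] <> l' ++ [t] -> 7 * r < d (D (f l s)) (D (f l' t))) /\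
    r <= sg)).
  { apply small_and; [|apply small_and; [|now apply small_le]].
    - apply small_idx; intros l Hl. apply small_range; intros s Hs.
      destruct (Ball_open c l _ (proj1 (Hf l s Hl Hs))) as [r [Hr H]].
      exists (r / 2). split; [lra|]. intros r' Hr' y Hy. apply H; lra.
    - apply small_idx; intros l Hl. apply small_idx; intros l' Hl'.
      apply small_range; intros s Hs. apply small_range; intros t Ht.
      apply small_imp; intros Hne.
      (* Siblings are distinct by the choice of [f]; points with different parents lie in disjoint
         balls. *)
      assert (Hd : 0 < d (D (f l s)) (D (f l' t))).
      { apply dist_pos. intros E. destruct (Hf l s Hl Hs) as (hB & _ & hD).
        destruct (Hf l' t Hl' Ht) as (hB' & _ & _).
        assert (El : l = l').
        { rewrite <- E in hB'. eapply (Ball_disjoint n c n); eauto. }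
        subst l'. apply (hD t); auto. intros ->. now apply Hne. }
      exists (d (D (f l s)) (D (f l' t)) / 8). split; [lra|]. intros; lra. }
  destruct (small_inv_nat _ Hrad) as [q [Hq1 [Hq2 Hq3]]].
  set (c' := extend n c N f q).
  assert (Hag : agree n c c') by apply extend_agree.
  assert (Hag' := agree_sym _ _ _ Hag).
  assert (Hback : forall l, idx (ca c') n l -> idx (ca c) n l)
    by (intros; eapply agree_idx; eauto).
  assert (Hca : forall k, (k <= n)%nat -> ca c k = ca c' k) by (intros; now apply Hag).
  assert (HcN : ca c' (S n) = N) by apply extend_ca.
  assert (Hcr : rad c' (S n) = / INR (S q)) by apply extend_rad.
  assert (Hcp : forall l s, idx (ca c) n l -> pt c' (l ++ [s]) = D (f l s))
    by (intros; now apply extend_pt).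
  clearbody c'.
  exists c'. split; [exact Hag|split; [|split; [exact HcN|]]].
  - intros k Hk. destruct (Nat.eq_dec k n) as [->|Hne].
    2:{ apply (agree_Step n c); [exact Hag|lia|apply HG; lia]. }
    unfold Step. rewrite <- (prod_a_ext (ca c)) by exact Hca.
    rewrite <- (Phi_ext (ca c)) by exact Hca.
    rewrite HcN, Hcr.
    split; [exact HN2|split; [exact HNp|split; [|split]]].
    + intros l i y Hl Hi Hd. apply Hback in Hl. rewrite Hcp in Hd by exact Hl.
      apply (agree_Ball n c c' n); auto. apply (Hq1 l Hl i Hi y Hd).
    + intros l l' Hl Hl' Hne.
      destruct (idx_S_inv _ _ _ Hl) as [l0 [i [-> [Hl0 Hi]]]].
      destruct (idx_S_inv _ _ _ Hl') as [l1 [j [-> [Hl1 Hj]]]].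
      rewrite HcN in Hi, Hj.
      apply Hback in Hl0, Hl1. rewrite !Hcp by assumption. auto.
    + intros Hodd l l' s t i j Hl Hl' Hb Hb' Hs Ht Hst Hi Hj.
      apply Hback in Hl, Hl'. rewrite !Hcp by assumption.
      assert (h1 := Hclust Hodd l' i j Hl' Hb' Hi Hj).
      assert (h2 := Hsg l Hl s Hs t Ht Hst).
      replace (f l) with (f1 l)
        by (unfold f; destruct (excluded_middle_informative _); [reflexivity|contradiction]).
      lra.
  - intros l s p0 Hl Hs. rewrite Hcp by exact Hl. now apply Hf.
Qed.

Lemma Ball_center c l : l <> [] -> Ball c l (pt c l).
Proof.
  destruct l as [|i l]; [congruence|]. intros _. unfold Ball. rewrite drefl. apply rad_pos.
Qed.

Lemma Ball_radius a c n l y : (1 <= n)%nat -> idx a n l ->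
  Ball c l y -> d (pt c l) y < rad c n.
Proof.
  intros Hn Hl. rewrite <- (idx_length _ _ _ Hl).
  destruct l as [|i l]; [rewrite <- (idx_length _ _ _ Hl) in Hn; simpl in Hn; lia|auto].
Qed.

(** Extending an odd level requires a single point to cluster around in each ball, which an
    arbitrary compact set fitting that level does not supply. Hence two levels are added at once:
    the even one follows a net of [A], the odd one repeats each new centre. *)
Lemma two_level_extension n c (A : KX d) r :
  Nat.Even n -> Geom n c -> Fits n c (proj1_sig A) -> 0 < r ->
  exists (c' : config) (B : KX d), agree n c c' /\ Geom (S (S n)) c' /\
    Fits (S (S n)) c' (proj1_sig B) /\ hdist_lt d (proj1_sig A) (proj1_sig B) r.
Proof.
  destruct A as [A [HA HA']]; simpl. intros Hev HG [HF1 HF2] Hr.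
  destruct (compact_net A (r / 8) HA) as [L [HL1 HL2]]; [lra|].
  assert (Hk : forall l, exists x, idx (ca c) n l -> A x /\ Ball c l x).
  { intros l. destruct (classic (idx (ca c) n l)) as [h|h]; [|exists (D O); tauto].
    destruct (HF2 l h) as [x Hx]. exists x; auto. }
  destruct (fun_choice _ Hk) as [kp Hkp].
  set (inB := fun l x => if excluded_middle_informative (Ball c l x) then true else false).
  assert (HinB : forall l x, inB l x = true <-> Ball c l x).
  { intros l x. unfold inB. destruct (excluded_middle_informative _); split; auto; discriminate. }
  (* Every ball needs the same number of points: the net points inside it are padded to length [N1]
     with copies of a point of [A] in that ball. *)
  set (N1 := Nat.max 2 (Nat.max (n * prod_a (ca c) n) (length L))).
  set (ps := fun l => filter (inB l) L ++ repeat (kp l) (N1 - length (filter (inB l) L))).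
  assert (Hlen : forall l, length (ps l) = N1).
  { intros l. unfold ps. rewrite length_app, repeat_length.
    assert (h := filter_length_le (inB l) L). lia. }
  assert (Hps : forall l p, idx (ca c) n l -> In p (ps l) -> A p /\ Ball c l p).
  { intros l p Hl Hp. apply in_app_or in Hp. destruct Hp as [Hp|Hp].
    - apply filter_In in Hp. destruct Hp as [h1 h2]. split; [auto|now apply HinB].
    - rewrite (repeat_spec _ _ _ Hp). auto. }
  destruct (one_level_extension n c N1 ps (r / 8)) as (c1 & Hag1 & HG1 & HN1 & Hd1);
    [exact HG|lra|lia|lia| | |].
  { intros l Hl. split; [apply Hlen|]. intros p Hp. now apply Hps. }
  { intros Hodd. exfalso. apply (Nat.Even_Odd_False n); assumption. }
  set (N2 := Nat.max 2 (S n * prod_a (ca c1) (S n))).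
  destruct (one_level_extension (S n) c1 N2 (fun l => repeat (pt c1 l) N2) (r / 8))
    as (c2 & Hag2 & HG2 & HN2 & Hd2); [exact HG1|lra|lia|lia| | |].
  { intros l Hl. rewrite repeat_length. split; [reflexivity|].
    intros p Hp. rewrite (repeat_spec _ _ _ Hp).
    apply Ball_center. eapply idx_nonnil; [|exact Hl]; lia. }
  { intros _ l p p' _ Hp Hp'. now rewrite (repeat_spec _ _ _ Hp), (repeat_spec _ _ _ Hp'). }
  assert (Hpar : forall l s, idx (ca c1) (S n) l -> (1 <= s <= N2)%nat ->
            d (pt c1 l) (pt c2 (l ++ [s])) < r / 8).
  { intros l s Hl Hs. specialize (Hd2 l s (pt c1 l) Hl Hs).
    now rewrite nth_repeat in Hd2. }
  assert (Hid : forall l s t, idx (ca c) n l -> (1 <= s <= N1)%nat -> (1 <= t <= N2)%nat ->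
            idx (ca c1) (S n) (l ++ [s]) /\ idx (ca c2) (S (S n)) ((l ++ [s]) ++ [t])).
  { intros l s t Hl Hs Ht.
    assert (h : idx (ca c1) (S n) (l ++ [s])).
    { apply idx_snoc; [eapply agree_idx; eauto|now rewrite HN1]. }
    split; [exact h|]. apply idx_snoc; [eapply agree_idx; eauto|now rewrite HN2]. }
  assert (Hinv : forall l, idx (ca c2) (S (S n)) l -> exists l0 s t,
            l = (l0 ++ [s]) ++ [t] /\ idx (ca c) n l0 /\ (1 <= s <= N1)%nat /\ (1 <= t <= N2)%nat).
  { intros l Hl. destruct (idx_S_inv _ _ _ Hl) as (l1 & t & -> & Hl1 & Ht).
    rewrite HN2 in Ht. eapply agree_idx in Hl1; [|apply agree_sym; exact Hag2|lia].
    destruct (idx_S_inv _ _ _ Hl1) as (l0 & s & -> & Hl0 & Hs).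
    rewrite HN1 in Hs. eapply agree_idx in Hl0; [|apply agree_sym; exact Hag1|lia].
    now exists l0, s, t. }
  (* The net and the two extensions each cost at most [r / 8], which stays below [r / 2]. *)
  assert (Hnear : forall x, A x -> exists y,
            ((In y L /\ isolated y) \/ exists l, idx (ca c2) (S (S n)) l /\ y = pt c2 l) /\
            d x y < r / 2).
  { intros x Hx. destruct (HL2 x Hx) as [y [Hy Hxy]].
    destruct (HF1 y (HL1 y Hy)) as [Hi|[l [Hl HB]]].
    { exists y; split; [auto|lra]. }
    assert (Hin : In y (ps l)).
    { apply in_or_app; left. apply filter_In; split; [exact Hy|now apply HinB]. }
    destruct (In_nth _ _ y Hin) as [i [Hi Hnth]]. rewrite Hlen in Hi.
    (* Entries of multi-indices start at 1 and list positions at 0; any child of the new centre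
       would do, and the first is taken. *)
    destruct (Hid l (S i) 1%nat Hl) as [h1 h2]; [lia|lia|].
    eexists; split; [right; eexists; split; [exact h2|reflexivity]|].
    assert (h3 := Hd1 l (S i) y Hl ltac:(lia)).
    replace (S i - 1)%nat with i in h3 by lia. rewrite Hnth in h3.
    assert (h4 := Hpar _ 1%nat h1 ltac:(lia)).
    assert (h5 := dtri x y (pt c1 (l ++ [S i]))).
    assert (h6 := dtri x (pt c1 (l ++ [S i])) (pt c2 ((l ++ [S i]) ++ [1%nat]))). lra. }
  (* The isolated net points are kept as they are, since the balls lie in the perfect part and
     cannot contain them. *)
  destruct (finite_KX (fun y => (In y L /\ isolated y) \/
              exists l, idx (ca c2) (S (S n)) l /\ y = pt c2 l)) as [B HB].
  { destruct (idx_finite (ca c2) (S (S n))) as [I HI].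
    apply finite_set_subset with (L ++ map (pt c2) I).
    intros y [[h _]|[l [Hl ->]]]; apply in_or_app; [now left|right].
    now apply in_map, HI. }
  { destruct HA' as [x Hx]. destruct (Hnear x Hx) as [y [Hy _]]. now exists y. }
  exists c2, B. split; [|split; [exact HG2|split; [split|]]].
  - apply agree_trans with c1; [exact Hag1|]. apply agree_le with (S n); [lia|exact Hag2].
  - intros y Hy. apply HB in Hy. destruct Hy as [[_ h]|[l [Hl ->]]]; [now left|right].
    exists l; split; [exact Hl|]. apply Ball_center. eapply idx_nonnil; [|exact Hl]; lia.
  - intros l Hl. exists (pt c2 l). split; [apply HB; right; now exists l|].
    apply Ball_center. eapply idx_nonnil; [|exact Hl]; lia.
  - apply hdist_lt_intro with (r / 2); [lra| |].
    + intros x Hx. destruct (Hnear x Hx) as [y [Hy Hd]]. exists y; split; [now apply HB|exact Hd].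
    + intros y Hy. apply HB in Hy. destruct Hy as [[Hy _]|[l [Hl ->]]].
      { exists y; split; [auto|]. rewrite drefl; lra. }
      destruct (Hinv l Hl) as (l0 & s & t & -> & Hl0 & Hs & Ht).
      destruct (Hid l0 s t Hl0 Hs Ht) as [h1 _].
      exists (nth (s - 1) (ps l0) (D O)). split.
      { apply (Hps l0); [exact Hl0|]. apply nth_In. rewrite Hlen; lia. }
      assert (h2 := Hd1 l0 s (D O) Hl0 Hs). assert (h3 := Hpar _ t h1 Ht).
      assert (h4 := dtri (nth (s - 1) (ps l0) (D O)) (pt c1 (l0 ++ [s]))
                      (pt c2 ((l0 ++ [s]) ++ [t]))). lra.
Qed.

(** * The exceptional sets and their countability *)

Definition stuck (n : nat) (c : config) (A : KX d) : Prop :=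
  Geom n c /\ Fits n c (proj1_sig A) /\
  forall c', agree n c c' -> Geom (S (S n)) c' -> ~ Fits (S (S n)) c' (proj1_sig A).

Lemma stuck_nowhere_dense n c : Nat.Even n -> Knowhere_dense d (stuck n c).
Proof.
  intros Hev. apply Knowhere_dense_intro. intros A r [HG [HF _]] Hr.
  destruct (two_level_extension n c A r Hev HG HF Hr) as (c' & B & Hag & HG' & HF' & Hd).
  exists B, (fun C => Fits (S (S n)) c' (proj1_sig C)).
  split; [apply Fits_open|split; [exact HF'|split; [exact Hd|]]].
  intros C HC (_ & _ & Hn). exact (Hn c' Hag HG' HC).
Qed.

Definition decode_config (z : nat) : config :=
  let (za, y) := Cantor.of_nat z in
  let (zx, zr) := Cantor.of_nat y in
  Config (fun k => nth k (decode za) O) (fun l => nth (encode l) (decode zx) O)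
         (fun k => nth k (decode zr) O).

Lemma config_code n c : exists z, agree n c (decode_config z).
Proof.
  destruct (nat_fun_code (ca c) n) as [za Ha].
  destruct (nat_fun_code (cr c) n) as [zr Hr].
  destruct (fun_choice _ (idx_finite (ca c))) as [L HL].
  destruct (list_fun_code (cx c) (flat_map L (seq 0 (S n)))) as [zx Hx].
  exists (Cantor.to_nat (za, Cantor.to_nat (zx, zr))).
  unfold decode_config. rewrite !cancel_of_to. split; simpl ca; simpl cr; simpl cx.
  - intros k Hk. rewrite Ha, Hr; auto.
  - intros k l Hk Hl. symmetry. apply Hx. apply in_flat_map. exists k.
    split; [apply in_seq; lia|now apply HL].
Qed.

(** * Passage to the limit along a chain of configurations *)

(** The chain is built along even levels only; this recovers the odd ones. Balls are nested, and
    every ball has at least one child. *)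
Lemma Fits_pred n c K : Geom (S n) c -> Fits (S n) c K -> Fits n c K.
Proof.
  intros HG [H1 H2]. destruct (HG n ltac:(lia)) as (Ha & _ & Hn & _).
  assert (HB : forall l i x, idx (ca c) n l -> (1 <= i <= ca c (S n))%nat ->
            Ball c (l ++ [i]) x -> Ball c l x).
  { intros l i x Hl Hi Hx. apply (Hn l i x Hl Hi). apply Rlt_le.
    apply (Ball_radius (ca c)); [lia|now apply idx_snoc|exact Hx]. }
  split.
  - intros x Hx. destruct (H1 x Hx) as [h|[l [Hl Hlx]]]; [now left|right].
    destruct (idx_S_inv _ _ _ Hl) as (l0 & i & -> & Hl0 & Hi). exists l0; split; [exact Hl0|].
    now apply (HB l0 i).
  - intros l Hl. destruct (H2 (l ++ [1%nat])) as [x [Hx HBx]]; [apply idx_snoc; [exact Hl|lia]|].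
    exists x; split; [exact Hx|]. apply (HB l 1%nat); auto; lia.
Qed.

Lemma limit_balanced c K : mcompact d K -> (forall n, Geom n c) -> (forall n, Fits n c K) ->
  balanced d (fun x => K x /\ ~ isolated x).
Proof.
  intros HK HG HF.
  assert (HS : forall k, Step k c) by (intros k; apply (HG (S k)); lia).
  (* Closed balls make the pieces closed, and [Step] nests closed balls in the open balls of the
     level before. *)
  set (C := fun l x => K x /\ d (pt c l) x <= rad c (length l)).
  assert (Ha : forall n, (1 <= n)%nat -> (2 <= ca c n)%nat).
  { intros [|n] Hn; [lia|]. apply (HS n). }
  assert (HPhi : index_function (ca c) (Phi (ca c))).
  { apply Phi_index_function. intros n Hn. specialize (Ha n Hn); lia. }
  assert (Hsub : forall n l i, (1 <= n)%nat -> idx (ca c) n l -> (1 <= i <= ca c (S n))%nat ->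
            subset (C (l ++ [i])) (C l)).
  { intros n l i Hn Hl Hi x [Hx Hd]. split; [exact Hx|].
    rewrite length_app, Nat.add_1_r, (idx_length _ _ _ Hl) in Hd.
    destruct (HS n) as (_ & _ & Hnest & _). rewrite (idx_length _ _ _ Hl). apply Rlt_le.
    apply (Ball_radius (ca c)); [exact Hn|exact Hl|]. now apply (Hnest l i). }
  assert (Hfirst : forall k n l, (1 <= k <= n)%nat -> idx (ca c) n l ->
            subset (C l) (C (firstn k l))).
  { intros k n. induction n as [|n IH]; intros l Hk Hl; [lia|].
    destruct (Nat.eq_dec k (S n)) as [->|Hne].
    - rewrite firstn_all2; [intros x Hx; exact Hx|]. rewrite (idx_length _ _ _ Hl); lia.
    - destruct (idx_S_inv _ _ _ Hl) as (l0 & i & -> & Hl0 & Hi).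
      rewrite firstn_app, (idx_length _ _ _ Hl0).
      replace (k - n)%nat with O by lia. rewrite firstn_O, app_nil_r.
      intros x Hx. apply IH; [lia|exact Hl0|]. apply (Hsub n l0 i); auto; lia. }
  assert (Hne : forall n l, (1 <= n)%nat -> idx (ca c) n l -> nonempty (C l)).
  { intros n l Hn Hl. destruct (proj2 (HF n) l Hl) as [x [Hx HB]]. exists x; split; [exact Hx|].
    apply Rlt_le. rewrite (idx_length _ _ _ Hl). now apply (Ball_radius (ca c)). }
  assert (Hsep : forall n l l' x y, (1 <= n)%nat -> idx (ca c) n l -> idx (ca c) n l' ->
            l <> l' -> C l x -> C l' y -> 5 * rad c n <= d x y).
  { intros [|n] l l' x y Hn Hl Hl' Hll [_ Hx] [_ Hy]; [lia|].
    rewrite (idx_length _ _ _ Hl) in Hx. rewrite (idx_length _ _ _ Hl') in Hy.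
    destruct (HS n) as (_ & _ & _ & Hs & _). assert (h := Hs l l' Hl Hl' Hll).
    assert (h1 := dtri (pt c l) x (pt c l')). assert (h2 := dtri x y (pt c l')).
    rewrite (dsym y) in h2. lra. }
  (* If the prefix of [l] of the length of [Phi] differed from [Phi], a point of the piece at [l]
     would lie in two distinct pieces of one level, which are a positive distance apart. *)
  assert (Hbelow : forall n l, Nat.Odd n -> idx (ca c) n l ->
            (subset (C l) (C (Phi (ca c) n)) <-> below (Phi (ca c) n) l)).
  { intros n l Hodd Hl. destruct (proj1 HPhi n Hodd) as [k [Hk Hp]].
    unfold below. rewrite (idx_length _ _ _ Hp). split.
    - intros Hs. apply NNPP; intros Hneq.
      destruct (Hne n l ltac:(lia) Hl) as [x Hx].
      assert (h := Hsep k _ _ x x ltac:(lia) (idx_firstn _ _ k _ (proj2 Hk) Hl) Hp Hneq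
                     (Hfirst k n l Hk Hl x Hx) (Hs x Hx)).
      rewrite drefl in h. assert (h' := rad_pos c k). lra.
    - intros <-. now apply (Hfirst k n). }
  exists (ca c), C, (fun n => 2 * rad c n), (Phi (ca c)).
  split; [intros n Hn; specialize (Ha n Hn); lia|].
  split; [intros n _; assert (h := rad_pos c n); lra|].
  split.
  { intros n l Hn Hl. split; [now apply (Hne n)|].
    intros x Hx. split.
    - apply (compact_closed K HK). intros e He. destruct (Hx e He) as [y [[Hy _] Hd]].
      now exists y.
    - apply Rnot_lt_le; intros Hlt.
      destruct (Hx (d (pt c l) x - rad c (length l))) as [y [[_ Hy] Hd]]; [lra|].
      assert (h := dtri (pt c l) y x). rewrite (dsym y) in h. lra. }
  split; [exact HPhi|]. split.
  { intros x; split.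
    - intros [Hx Hi] n Hn. destruct (proj1 (HF n) x Hx) as [h|[l [Hl HB]]]; [contradiction|].
      exists l; split; [exact Hl|]. split; [exact Hx|]. apply Rlt_le.
      rewrite (idx_length _ _ _ Hl). now apply (Ball_radius (ca c)).
    (* Level 1 already suffices: its closed balls lie in the root, which contains no isolated
       point. *)
    - intros H. destruct (H 1%nat ltac:(lia)) as [l [Hl [Hx Hd]]]. split; [exact Hx|].
      apply perfect_part_not_isolated.
      destruct (idx_S_inv _ _ _ Hl) as (l0 & i & -> & Hl0 & Hi).
      rewrite (idx_length _ _ _ Hl) in Hd.
      apply (Ball_perfect O c O l0); [apply HG|lia|exact Hl0|].
      destruct (HS O) as (_ & _ & Hn & _). now apply (Hn l0 i). }
  split; [now apply Ha|]. split; [intros n _; apply (HS n)|]. split; [exact Hsub|].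
  split.
  { intros n l Hn Hl x y [_ Hx] [_ Hy]. rewrite (idx_length _ _ _ Hl) in Hx, Hy.
    assert (h := dtri x (pt c l) y). rewrite (dsym x (pt c l)) in h. lra. }
  split.
  { intros n l l' Hn Hl Hl' Hll. exists (5 * rad c n).
    split; [assert (h := rad_pos c n); lra|]. intros x y; now apply Hsep. }
  intros n l l' Hn Hodd Hl Hl' Hin Hout s t Hs Ht Hst.
  apply Hbelow in Hin; [|exact Hodd|exact Hl]. rewrite Hbelow in Hout by assumption.
  destruct (HS n) as (_ & _ & _ & _ & Ho).
  assert (Hlt : forall m i, idx (ca c) n m -> length (m ++ [i]) = S n).
  { intros m i Hm. rewrite length_app, (idx_length _ _ _ Hm). simpl; lia. }
  (* The diameter is at most the distance of the two centres minus [5 - 2 = 3] radii, while the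
     pieces are at least that distance minus 2 radii apart. *)
  exists (d (pt c (l ++ [s])) (pt c (l ++ [t])) - 3 * rad c (S n)). split.
  - intros x y [i [Hi [_ Hx]]] [j [Hj [_ Hy]]]. rewrite Hlt in Hx, Hy by assumption.
    assert (h := Ho Hodd l l' s t i j Hl Hl' Hin Hout Hs Ht Hst Hi Hj).
    assert (h1 := dtri x (pt c (l' ++ [i])) y).
    assert (h2 := dtri (pt c (l' ++ [i])) (pt c (l' ++ [j])) y).
    rewrite (dsym x (pt c (l' ++ [i]))) in h1. lra.
  - exists (d (pt c (l ++ [s])) (pt c (l ++ [t])) - 2 * rad c (S n)).
    split; [assert (h := rad_pos c (S n)); lra|].
    intros x y [_ Hx] [_ Hy]. rewrite Hlt in Hx, Hy by assumption.
    assert (h1 := dtri (pt c (l ++ [s])) x (pt c (l ++ [t]))).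
    assert (h2 := dtri x y (pt c (l ++ [t]))). rewrite (dsym y) in h2. lra.
Qed.

Lemma never_stuck_balanced (A : KX d) :
  (forall m z, ~ stuck (2 * m) (decode_config z) A) ->
  (exists c, Fits 0 c (proj1_sig A)) ->
  balanced d (fun x => proj1_sig A x /\ ~ isolated x).
Proof.
  intros Hns [c0 Hc0].
  destruct (dependent_choice_nat
    (fun m c => Geom (2 * m) c /\ Fits (2 * m) c (proj1_sig A))
    (fun m c c' => agree (2 * m) c c')) as [u Hu].
  { exists c0. split; [intros k Hk; lia|exact Hc0]. }
  (* The current configuration is replaced by a coded one with the same levels up to [2 * m]; as [A]
     is not stuck there, an extension exists. *)
  { intros m c [HG HF]. destruct (config_code (2 * m) c) as [z Hz].
    apply NNPP; intros Hn. apply (Hns m z). split; [|split].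
    - now apply agree_Geom with c.
    - now apply agree_Fits with c.
    - intros c' Hag HG' HF'. apply Hn. exists c'.
      replace (2 * S m)%nat with (S (S (2 * m))) by lia.
      split; [now apply agree_trans with (decode_config z)|auto]. }
  assert (Hch : forall m k, agree (2 * m) (u m) (u (m + k)%nat)).
  { intros m k. induction k as [|k IH].
    - rewrite Nat.add_0_r. split; auto.
    - rewrite Nat.add_succ_r. apply agree_trans with (u (m + k)%nat); [exact IH|].
      apply agree_le with (2 * (m + k))%nat; [lia|apply Hu]. }
  assert (Hchm : forall k m, agree (2 * Nat.min k m) (u k) (u m)).
  { intros k m. destruct (Nat.le_ge_cases k m) as [h|h].
    - rewrite Nat.min_l by exact h. replace m with (k + (m - k))%nat by lia. apply Hch.
    - rewrite Nat.min_r by exact h. apply agree_sym.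
      replace k with (m + (k - m))%nat by lia. apply Hch. }
  (* The diagonal configuration: level [k] is read off from [u k], whose levels up to [2 * k] no
     longer change. *)
  set (c := Config (fun k => ca (u k) k) (fun l => cx (u (length l)) l) (fun k => cr (u k) k)).
  assert (Hc : forall m, agree (2 * m) (u m) c).
  { intros m. split.
    - intros k Hk. simpl.
      destruct (proj1 (Hchm k m) k) as [h1 h2]; [lia|auto].
    - intros k l Hk Hl. simpl. rewrite (idx_length _ _ _ Hl).
      apply (proj2 (agree_sym _ _ _ (Hchm k m)) k); [lia|exact Hl]. }
  assert (HG : forall n, Geom n c).
  { intros n k Hk. apply (agree_Geom (2 * n) (u n) c (Hc n)); [apply Hu|lia]. }
  apply limit_balanced with c; [apply (proj2_sig A)|exact HG|].
  assert (HF : forall m, Fits (2 * m) c (proj1_sig A)).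
  { intros m. apply agree_Fits with (u m); [apply Hc|apply Hu]. }
  intros n. destruct (Nat.Even_or_Odd n) as [[m ->]|[m ->]]; [apply HF|].
  apply Fits_pred; [apply HG|].
  replace (S (2 * m + 1)) with (2 * S m)%nat by lia. apply HF.
Qed.

(** The perfect part and the singletons of isolated points form an open cover of [K]; the singletons
    in a finite subcover account for all isolated points of [K]. *)
Lemma compact_isolated_finite K : mcompact d K ->
  subset K (fun x => isolated x \/ perfect_part x) ->
  finite_set (fun x => K x /\ isolated x).
Proof.
  intros HK Hs.
  destruct (HK (option X) (fun o y => match o with
    | Some x => isolated x /\ y = x | None => perfect_part y end)) as [L HL].
  - intros [x|]; [|apply perfect_part_open]. intros y [[r [Hr H]] ->].
    exists r; split; [exact Hr|]. intros z Hz. split; [now exists r|now apply H].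
  - intros x Hx. destruct (Hs x Hx) as [h|h]; [now exists (Some x)|now exists None].
  - apply finite_set_subset
      with (flat_map (fun o => match o with Some x => [x] | None => [] end) L).
    intros x [Hx Hi]. destruct (HL x Hx) as [[y|] [Hy h]].
    + apply in_flat_map. exists (Some y). split; [exact Hy|left; symmetry; apply h].
    + exfalso. now apply (perfect_part_not_isolated x).
Qed.

Lemma generic_balanced_union_finite :
  generic d (fun K : X -> Prop => @finite_set X K \/
    exists B F : X -> Prop, mcompact d B /\ balanced d B /\ @finite_set X F /\
      (forall x, K x <-> B x \/ F x)).
Proof.
  (* Index 0 is the boundary set; [S z] codes a pair of half a level and a configuration. *)
  exists (fun n => match n with
    | O => fun A => ~ subset (proj1_sig A) (fun x => isolated x \/ perfect_part x)
    | S z => stuck (2 * fst (Cantor.of_nat z)) (decode_config (snd (Cantor.of_nat z)))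
    end).
  split.
  - intros [|z]; [apply nowhere_dense_boundary|]. apply stuck_nowhere_dense. now eexists.
  - intros A HnP. apply NNPP; intros Hn. apply HnP.
    assert (Hs : subset (proj1_sig A) (fun x => isolated x \/ perfect_part x)).
    { apply NNPP; intros h. apply Hn. now exists O. }
    assert (Hns : forall m z, ~ stuck (2 * m) (decode_config z) A).
    { intros m z h. apply Hn. exists (S (Cantor.to_nat (m, z))). now rewrite cancel_of_to. }
    destruct A as [A [HA HA']]. simpl in Hs |- *.
    assert (Hfin := compact_isolated_finite A HA Hs).
    destruct (classic (exists x, A x /\ perfect_part x)) as [h|h].
    + right. exists (fun x => A x /\ ~ isolated x), (fun x => A x /\ isolated x).
      split; [apply compact_inter_closed; [exact HA|apply isolated_open]|].
      split; [|split; [exact Hfin|intros x; tauto]].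
      refine (never_stuck_balanced (exist _ A (conj HA HA')) Hns _).
      (* Any configuration will do here, since level 0 consists of the root alone. *)
      exists (decode_config O). split; simpl.
      * intros x Hx. destruct (Hs x Hx) as [h'|h']; [now left|right].
        exists []; split; [apply idx_0|exact h'].
      * intros l Hl. rewrite (idx_nil _ _ Hl). exact h.
    + left. destruct Hfin as [l Hl]. exists l. intros x. rewrite <- Hl. split; [|tauto].
      intros Hx. split; [exact Hx|]. destruct (Hs x Hx) as [h'|h']; [exact h'|].
      exfalso. apply h. now exists x.
Qed.

End Generic.

Theorem theorem4p5 (X : Type) (d : X -> X -> R)
  (Hmetric : is_metric d) (Hcomplete : mcomplete d) (Hsep : separable d) :
  generic d (fun K : X -> Prop =>
    @finite_set X K \/
    exists B F : X -> Prop,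
      mcompact d B /\ balanced d B /\ @finite_set X F /\
      (forall x, K x <-> B x \/ F x)).
Proof.
  destruct Hsep as [D HD].
  destruct (classic (exists x0 : X, True)) as [[x0 _]|Hempty].
  - apply generic_balanced_union_finite
      (* Gaps in the enumeration are filled with the point [x0], which does not affect density. *)
      with (D := fun n => match D n with Some y => y | None => x0 end); [exact Hmetric|].
    intros x e He. destruct (HD x e He) as (n & y & E & Hd). exists n. now rewrite E.
  (* In an empty space there is no non-empty compact set, so empty sets cover everything. *)
  - exists (fun _ _ => False). split.
    + intros _ V _ Hc A HA. destruct (Hc A HA 1 Rlt_0_1) as [B [[] _]].
    + intros [A [HA [x Hx]]]. exfalso. apply Hempty. now exists x.
Qed.
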